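(* Let $H$ be a real Hilbert space, $C\subset H$ a nonempty closed convex set, and let $A,T:H\to H$ be mappings such that: (1) $A$ is monotone and $L$-Lipschitz continuous on $H$ for some $L>0$; (2) $T$ is $\lambda$-demicontractive for some $0\le\lambda<1$, and $I-T$ is demiclosed at zero; (3) $\operatorname{Fix}(T)\cap \mathrm{VI}(C,A)\neq\emptyset$; (4) $\{\theta_k\}_{k\ge1}\subset(0,1)$ satisfies $\lim_{k\to\infty}\theta_k=0$ and $\sum_{k=1}^\infty\theta_k=\infty$; $\{\zeta_k\}_{k\ge1}$ is a sequence of positive numbers with $\lim_{k\to\infty}\zeta_k/\theta_k=0$; and $\{\eta_k\}_{k\ge1}$ is a positive sequence for which there are $a>0$, $b>0$ such that $\eta_k\in(a,b)\subset\big(0,(1-\lambda)(1-\theta_k)\big)$ for all $k$. Let $\delta>0$, $\gamma_1>0$, $\phi\in(0,1)$, let $x^0,x^1\in H$ be arbitrary, and for $k\ge1$ define $$s^k=x^k+\delta_k(x^k-x^{k-1}),\qquad \delta_k=\begin{cases}\min\Big\{\dfrac{\zeta_k}{\|x^k-x^{k-1}\|},\delta\Big\}, & x^k\ne x^{k-1},\\ \delta, & \text{otherwise},\end{cases}$$ $$y^k=P_C(s^k-\gamma_kAs^k),\qquad z^k=y^k-\gamma_k(Ay^k-As^k),$$ $$x^{k+1}=(1-\theta_k-\eta_k)z^k+\eta_kTz^k,$$ $$\gamma_{k+1}=\begin{cases}\min\Big\{\dfrac{\phi\|s^k-y^k\|}{\|As^k-Ay^k\|},\gamma_k\Big\}, &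 As^k-Ay^k\neq0,\\ \gamma_k, & \text{otherwise}.\end{cases}$$ Then the sequence $\{x^k\}$ converges in norm to $u\in\operatorname{Fix}(T)\cap\mathrm{VI}(C,A)$, where $\|u\|=\min\{\|p\|:p\in\operatorname{Fix}(T)\cap\mathrm{VI}(C,A)\}$.
   Context: $\operatorname{Fix}(T)=\{p\in H:Tp=p\}$. $\mathrm{VI}(C,A)=\{p\in C:\langle Ap,x-p\rangle\ge0\ \ \forall x\in C\}$. $P_C$ is the metric projection of $H$ onto $C$. $I$ is the identity on $H$. $A$ is monotone if $\langle Ax-Ay,x-y\rangle\ge0$ for all $x,y\in H$, and $L$-Lipschitz continuous if $\|Ax-Ay\|\le L\|x-y\|$ for all $x,y\in H$. $T$ is $\lambda$-demicontractive ($0\le\lambda<1$) if $\|Tx-z\|^2\le\|x-z\|^2+\lambda\|(I-T)x\|^2$ for all $x\in H$ and all $z\in\operatorname{Fix}(T)$. $I-T$ is demiclosed at zero if, for every sequence $\{v^k\}\subset H$, $v^k\rightharpoonup v$ (weakly) and $(I-T)v^k\to0$ (in norm) imply $v\in\operatorname{Fix}(T)$. Superscripts on vectors are sequence indices. *)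

(* Defs.v *)
From mathcomp Require Import all_boot all_order all_algebra sesquilinear.
From mathcomp Require Import all_classical all_reals all_analysis.
Import Order.TTheory GRing.Theory Num.Theory.
Import numFieldNormedType.Exports.
Set Implicit Arguments.
Unset Strict Implicit.
Unset Printing Implicit Defensive.
Local Open Scope classical_set_scope.
Local Open Scope ring_scope.

(* A real Hilbert space is a complete normed module H over R : realType together
   with an inner product dot : {dot H for idfun} (symmetric, bilinear, positive
   definite) that induces the norm of H. *)
Definition induces_norm (R : realType) (H : completeNormedModType R)
    (dot : {dot H for idfun}) : Prop :=
  forall x : H, dot x x = `|x| ^+ 2.

Definition Fix (H : Type) (T : H -> H) : set H := [set p | T p = p].

Definition VI (R : realType) (H : completeNormedModType R)
    (dot : {dot H for idfun}) (C : set H) (A : H -> H) : set H :=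
  [set p | C p /\ forall x, C x -> 0 <= dot (A p) (x - p)].

(* For C nonempty, closed and convex in a Hilbert space the nearest point
   exists and is unique; for other sets get picks an arbitrary nearest point,
   or a default value if there is none. *)
Definition metric_projection (R : realType) (H : completeNormedModType R)
    (C : set H) (x : H) : H :=
  get [set p | C p /\ forall q, C q -> `|x - p| <= `|x - q|].

Definition monotone_operator (R : realType) (H : completeNormedModType R)
    (dot : {dot H for idfun}) (A : H -> H) : Prop :=
  forall x y : H, 0 <= dot (A x - A y) (x - y).

Definition demicontractive (R : realType) (H : completeNormedModType R)
    (lambda : R) (T : H -> H) : Prop :=
  forall x z : H, Fix T z ->
    `|T x - z| ^+ 2 <= `|x - z| ^+ 2 + lambda * `|x - T x| ^+ 2.

Definition weakly_converges (R : realType) (H : completeNormedModType R)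
    (dot : {dot H for idfun}) (v_ : nat -> H) (v : H) : Prop :=
  forall w : H, (fun k => dot (v_ k) w) @ \oo --> (dot v w : R).

(* Demiclosedness at zero of I - T, phrased in terms of T. *)
Definition demiclosed_at_zero (R : realType) (H : completeNormedModType R)
    (dot : {dot H for idfun}) (T : H -> H) : Prop :=
  forall (v_ : nat -> H) (v : H),
    weakly_converges dot v_ v ->
    (fun k => v_ k - T (v_ k)) @ \oo --> (0 : H) ->
    Fix T v.

(* Main.v *)
Require Import Defs.
From mathcomp Require Import all_boot all_order all_algebra sesquilinear.
From mathcomp Require Import all_classical all_reals all_analysis.
From mathcomp Require Import ring lra.
Import Order.TTheory GRing.Theory Num.Theory.
Import numFieldNormedType.Exports.
Local Open Scope classical_set_scope.
Local Open Scope ring_scope.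

(** Factor the last update as x_{k+1} = (1 - theta_k) v_k, where
    v_k = z_k - beta_k (z_k - T z_k) and beta_k = eta_k / (1 - theta_k): the
    scheme is a Halpern iteration anchored at 0, which is why its limit is the
    solution u of least norm, that is, the projection of 0 onto the closed
    convex set S = Fix T `&` VI(C, A).

    Put a_k = |x_k - u|^2. The forward-backward-forward estimate [tseng_step]
    (monotonicity of A and the variational inequality of the projection),
    demicontractivity ([demicontractive_relaxation]) and the anchoring
    inequality ([anchored_step]) add up, for large k, to
      a_{k+1} <= (1 - theta_k) a_k + theta_k d_k - e_k,
    where e_k is a positive combination of |s_k - y_k|^2 and |z_k - T z_k|^2,
    and d_k is 2 <u, u - x_{k+1}> plus a multiple of zeta_k / theta_k. The
    adaptive step sizes cause no loss: they are nonincreasing and at least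
    min(phi / L, gamma_1), so the ratio of consecutive ones tends to 1
    ([adaptive_stepsize]).

    The asymptotic information is: for each eps > 0 there is mu > 0 such that,
    for large k, e_k < mu forces d_k <= eps. Otherwise there are indices along
    which e tends to 0 and d exceeds eps. Bounded sequences of a Hilbert space
    have weakly convergent subsequences
    ([bounded_weakly_converging_subsequence]); the weak limit v is in Fix T by
    demiclosedness and solves the variational inequality by Minty's lemma
    ([weak_limit_VI]), so d tends to 2 <u, u - v> <= 0 along the subsequence,
    a contradiction.

    This suffices ([dichotomy_cvg0]). Since d is bounded and theta tends to 0,
    an index with e_k >= mu has theta_k d_k <= e_k, and an index with e_k < mu
    has d_k <= eps. So a_{k+1} <= (1 - theta_k) a_k + theta_k eps for all large
    k, and the divergence of the sum of the theta_k drives a below 2 eps. *)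

Set Implicit Arguments.
Unset Strict Implicit.

(** * Inner products, convex sets and half-spaces *)

Lemma convex_setP {R : realType} {H : completeNormedModType R} (C : set H) :
  convex_set C <->
  forall (x y : H) (t : R), 0 <= t <= 1 -> C x -> C y -> C (y + t *: (x - y)).
Proof.
have segE (x y : H) (t : R) : y + t *: (x - y) = t *: x + (1 - t) *: y.
  by rewrite scalerBr scalerBl scale1r addrCA.
split=> [C_convex x y t /andP[t0 t1] Cx Cy|C_convex x y t].
  have := C_convex x y (Itv01 t0 t1).
  by rewrite !inE segE; apply.
rewrite !inE => Cx Cy; have := C_convex x y t%:num _ Cx Cy.
by rewrite segE; apply; rewrite ge0 le1.
Qed.

Section InnerProduct.
Context {R : realType} {H : completeNormedModType R}.
Context {dot : {dot H for idfun}} (hdot : induces_norm dot).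
Implicit Types (x y w : H) (a : R).

Lemma dotDl x y w : dot (x + y) w = dot x w + dot y w :> R.
Proof. by rewrite linearDl. Qed.

Lemma dotDr x y w : dot w (x + y) = dot w x + dot w y :> R.
Proof. by rewrite linearD. Qed.

Lemma dotZr a x y : dot x (a *: y) = a * dot x y :> R.
Proof. by rewrite linearZ. Qed.

Lemma dotZl a x y : dot (a *: x) y = a * dot x y :> R.
Proof. by rewrite linearZl_LR. Qed.

Lemma dotNl x y : dot (- x) y = - dot x y :> R.
Proof. by rewrite -scaleN1r dotZl mulN1r. Qed.

Lemma dotNr x y : dot x (- y) = - dot x y :> R.
Proof. by rewrite -scaleN1r dotZr mulN1r. Qed.

Lemma dotC x y : dot x y = dot y x :> R.
Proof. by rewrite hermC /= expr0 mul1r. Qed.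

Lemma dot0l x : dot 0 x = 0 :> R.
Proof. by rewrite -(scale0r x) dotZl mul0r. Qed.

Lemma dot0r x : dot x 0 = 0 :> R.
Proof. by rewrite dotC dot0l. Qed.

Definition dotE := (dotDl, dotDr, dotNl, dotNr, dotZl, dotZr).

Lemma sqr_norm x : `|x| ^+ 2 = dot x x :> R.
Proof. by rewrite hdot. Qed.

(** Expand the square of |y| x - |x| y and divide by 2 |x| |y|. *)
Lemma cauchy_schwarz x y : `|dot x y : R| <= `|x| * `|y|.
Proof.
suff dot_le x' y' : dot x' y' <= `|x'| * `|y'| :> R.
  by rewrite ler_norml dot_le andbT lerNl -dotNl (le_trans (dot_le _ _))// normrN.
have [->|x0] := eqVneq x' 0; first by rewrite dot0l normr0 mul0r.
have [->|y0] := eqVneq y' 0; first by rewrite dot0r normr0 mulr0.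
have xy_gt0 : 0 < `|x'| * `|y'| by rewrite mulr_gt0 // normr_gt0.
have := sqr_ge0 `| `|y'| *: x' - `|x'| *: y' |.
rewrite sqr_norm !dotE (dotC y' x') !hdot => h.
by rewrite -subr_ge0 -(pmulr_rge0 _ xy_gt0); lra.
Qed.

Lemma ler_dot_norm x y : dot x y <= `|x| * `|y| :> R.
Proof. exact: le_trans (ler_norm _) (cauchy_schwarz x y). Qed.

Lemma cvg_dotl {I : Type} {F : set_system I} {FF : Filter F}
    (v_ : I -> H) v w :
  v_ @ F --> v -> (fun k => dot (v_ k) w : R) @ F --> (dot v w : R).
Proof.
move=> v_v; apply/cvgrPdist_le => /= e e0.
have d0 : 0 < e / (`|w| + 1) by rewrite divr_gt0 // ltr_wpDl.
have /cvgrPdist_le/(_ _ d0) := v_v.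
apply: filterS => k hk.
rewrite -dotNl -dotDl (le_trans (cauchy_schwarz _ _)) //.
move: hk; rewrite ler_pdivlMr ?ltr_wpDl//.
have := normr_ge0 w. have := normr_ge0 (v - v_ k).
nra.
Qed.

Lemma closed_halfspace w (c : R) : closed [set p | dot p w <= c].
Proof.
apply: (@closed_comp _ _ (fun p => dot p w : R) [set t | t <= c]).
  by move=> p _; exact: cvg_dotl.
exact: closed_le.
Qed.

Lemma convex_halfspace w (c : R) : convex_set [set p | dot p w <= c].
Proof.
apply/convex_setP => x y t /andP[t0 t1] /= xc yc; rewrite !dotE; nra.
Qed.

End InnerProduct.

(** * Projections and weak compactness *)

(** Let t tend to 0: the first-order condition behind the two variational
    inequalities below. *)
Lemma ge0_of_forall_small {R : realType} (a b : R) :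
  (forall t, 0 < t <= 1 -> 0 <= a + t * b) -> 0 <= a.
Proof.
move=> ab_ge0; rewrite leNgt; apply/negP => a_lt0.
pose t := Num.min 1 (- a / (2 * (`|b| + 1))).
have b0 := normr_ge0 b.
have den_gt0 : 0 < 2 * (`|b| + 1) by lra.
have t_gt0 : 0 < t by rewrite lt_min ltr01 divr_gt0 // oppr_gt0.
have t_le : t * (2 * (`|b| + 1)) <= - a.
  by rewrite -ler_pdivlMr // ge_min lexx orbT.
have t01 : 0 < t <= 1 by rewrite t_gt0 ge_min lexx.
have := ab_ge0 t t01; have := ler_norm b; nra.
Qed.

Section Hilbert.
Context {R : realType} {H : completeNormedModType R}.
Context {dot : {dot H for idfun}} (hdot : induces_norm dot).
Implicit Types (x y w : H) (K : set H).

(** By the parallelogram identity, |w_n - w_k|^2 is twice the sum of the values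
    of the functional at w_n and w_k minus four times its value at their
    midpoint, which is at least m. *)
Lemma minimizing_sequence_cvg K (f : H -> R) (m : R) (w_ : nat -> H) :
  convex_set K ->
  (forall x y, f (x + y) = f x + f y) -> (forall a x, f (a *: x) = a * f x) ->
  (forall w, K w -> m <= `|w| ^+ 2 - 2 * f w) ->
  (forall n, K (w_ n)) ->
  (forall n, `|w_ n| ^+ 2 - 2 * f (w_ n) < m + n.+1%:R^-1) ->
  cvgn w_.
Proof.
move=> /convex_setP K_convex fD fZ m_lb Kw w_min.
have fN x : f (- x) = - f x by rewrite -scaleN1r fZ mulN1r.
have gap n k : `|w_ n - w_ k| ^+ 2 <= 2 * (n.+1%:R^-1 + k.+1%:R^-1).
  have half01 : 0 <= (2^-1 : R) <= 1 by lra.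
  have := m_lb _ (K_convex _ _ _ half01 (Kw n) (Kw k)).
  have := w_min n; have := w_min k.
  rewrite !(sqr_norm hdot) !(fD, fZ, fN) !dotE (dotC (w_ k) (w_ n)).
  set en := n.+1%:R^-1; set ek := k.+1%:R^-1; lra.
apply: cauchy_cvg; apply/cauchyP => e e0.
have e2 : 0 < e ^+ 2 / 4 by rewrite divr_gt0 // exprn_gt0.
have [N _ N_small] := near_infty_natSinv_lt (PosNum e2).
exists (w_ N), N => // n /= Nn; rewrite -ball_normE /=.
rewrite -(@ltr_pXn2r _ 2) ?nnegrE ?(ltW e0) //.
apply: le_lt_trans (gap _ _) _.
have := N_small _ (leqnn N); have := N_small _ Nn; rewrite /=;
  set en := n.+1%:R^-1; set eN := N.+1%:R^-1; lra.
Qed.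

(** The minimizer v over K of |w|^2 - 2 f w satisfies this first-order condition.
    With K the whole space it is the Riesz representation of f; with
    f = <x, _> it says that v is the projection of x onto K. *)
Lemma stampacchia K (f : H -> R) (M : R) :
  closed K -> convex_set K -> K !=set0 ->
  (forall x y, f (x + y) = f x + f y) -> (forall a x, f (a *: x) = a * f x) ->
  (forall x, `|f x| <= M * `|x|) ->
  exists2 v, K v & forall w, K w -> f (w - v) <= dot v (w - v).
Proof.
move=> K_closed K_convex [w0 Kw0] fD fZ f_bnd.
have fN x : f (- x) = - f x by rewrite -scaleN1r fZ mulN1r.
pose g w := `|w| ^+ 2 - 2 * f w.
pose m := inf (g @` K).
have g_lb : has_lbound (g @` K).
  exists (- M ^+ 2) => _ [w Kw <-]; rewrite /g.
  have := f_bnd w; have := ler_norm (f w); have := sqr_ge0 (`|w| - M); nra.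
have g_inf : has_inf (g @` K) by split => //; exists (g w0), w0.
have m_lb w : K w -> m <= g w by move=> Kw; apply: ge_inf => //; exists w.
have near_inf n : exists w, K w /\ g w < m + n.+1%:R^-1.
  have n0 : 0 < (n.+1%:R^-1 : R) by rewrite invr_gt0.
  by have [_ [w Kw <-] gw] := inf_adherent n0 g_inf; exists w.
have [w_ w_P] := choice near_inf.
have Kw n := (w_P n).1; have gw n := (w_P n).2.
have /cvg_ex[v w_v] : cvgn w_.
  exact: (minimizing_sequence_cvg K_convex fD fZ m_lb Kw gw).
have Kv : K v by apply: (closed_cvg _ K_closed) w_v; exact: nearW.
have fw_v : (f \o w_) @ \oo --> (f v : R).
  apply/cvgrPdist_le => /= e e0.
  have M1 : 0 < `|M| + 1 by have := normr_ge0 M; lra.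
  have /cvgrPdist_le/(_ _ (divr_gt0 e0 M1)) := w_v.
  apply: filterS => n; rewrite ler_pdivlMr // => hn.
  have := f_bnd (v - w_ n); rewrite fD fN.
  have := ler_norm M; have := normr_ge0 (v - w_ n); nra.
have gv : g v <= m.
  apply: (@ler_cvg_to _ \oo _ _ (g \o w_) (fun n => m + n.+1%:R^-1)) => /=.
  - apply: cvgB; last exact: cvgMr.
    by apply: cvgM; exact: cvg_norm.
  - by rewrite -[X in _ --> X]addr0; apply: cvgD; [exact: cvg_cst|exact: cvg_harmonic].
  - by apply: nearW => n; exact: ltW.
exists v => // w Kw_w.
rewrite -subr_ge0 -(pmulr_rge0 _ (ltr0n R 2)).
apply: (@ge0_of_forall_small _ _ (`|w - v| ^+ 2)) => t /andP[t0 t1].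
have t01 : 0 <= t <= 1 by rewrite ltW.
have := le_trans gv (m_lb _ ((convex_setP K).1 K_convex _ _ _ t01 Kw_w Kv)).
rewrite /g !(sqr_norm hdot) !(fD, fZ, fN) !dotE (dotC w v).
nra.
Qed.

End Hilbert.

Section Hilbert.
Context {R : realType} {H : completeNormedModType R}.
Context {dot : {dot H for idfun}} (hdot : induces_norm dot).
Implicit Types (x y w : H) (K : set H).

Lemma riesz (f : H -> R) (M : R) :
  (forall x y, f (x + y) = f x + f y) -> (forall a x, f (a *: x) = a * f x) ->
  (forall x, `|f x| <= M * `|x|) ->
  exists p, forall w, f w = dot p w.
Proof.
move=> fD fZ f_bnd.
have convexT : convex_set [set: H] by apply/convex_setP.
have [p _ p_min] := stampacchia hdot closedT convexT (ex_intro _ 0 I) fD fZ f_bnd.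
have f_le w : f w <= dot p w by have := p_min (p + w) I; rewrite addrC addKr.
exists p => w; apply/eqP; rewrite eq_le f_le /=.
by have := f_le (- w); rewrite -scaleN1r fZ dotZr !mulN1r lerN2.
Qed.

Lemma metric_projectionP K x : closed K -> convex_set K -> K !=set0 ->
  K (metric_projection K x) /\
  forall w, K w ->
    dot (x - metric_projection K x) (w - metric_projection K x) <= 0.
Proof.
move=> K_closed K_convex K_neq0.
have [p Kp p_min] : exists2 p, K p & forall w, K w -> dot x (w - p) <= dot p (w - p).
  apply: (stampacchia hdot (f := dot x) (M := `|x|)) => //.
  - by move=> a b; exact: dotDr.
  - by move=> a y; exact: dotZr.
  - exact: cauchy_schwarz.
have pythagoras w : K w -> `|x - p| ^+ 2 + `|p - w| ^+ 2 <= `|x - w| ^+ 2.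
  move=> Kw; have := p_min w Kw; rewrite !(sqr_norm hdot) !dotE.
  rewrite (dotC p x) (dotC w x) (dotC w p); lra.
pose nearest := [set p | K p /\ forall q, K q -> `|x - p| <= `|x - q|].
have p_nearest : nearest p.
  split=> // q Kq; rewrite -(@ler_pXn2r _ 2) ?nnegrE//.
  by have := pythagoras q Kq; have := sqr_ge0 `|p - q|; lra.
have [Kq q_min] : nearest (metric_projection K x) by exact: getI p_nearest.
suff -> : metric_projection K x = p.
  by split=> // w Kw; rewrite dotDl dotNl subr_le0; exact: p_min.
have := pythagoras _ Kq; have := q_min p Kp.
set q := metric_projection K x => qp /[dup] pq.
have : `|x - q| ^+ 2 <= `|x - p| ^+ 2 by rewrite ler_pXn2r ?nnegrE.
move=> le1 le2; apply/eqP; rewrite eq_sym -subr_eq0 -normr_le0.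
rewrite -(@ler_pXn2r _ 2) ?nnegrE// expr0n /=; lra.
Qed.

(** An ultrafilter that meets the preimage of every neighbourhood of a cluster
    point contains all these preimages. *)
Lemma ultra_bounded_cvg {I : Type} (U : set_system I) (u : I -> R) (B : R) :
  UltraFilter U -> (forall i, `|u i| <= B) -> exists l : R, u @ U --> l.
Proof.
move=> U_ultra u_bnd.
have u_itv : (u @ U) `[- B, B]%classic.
  suff : \forall i \near U, u i \in `[- B, B] by [].
  by apply: nearW => i; rewrite in_itv /= -ler_norml.
have [l [_ l_cluster]] := segment_compact (fmap_proper_filter u _) u_itv.
exists l => S l_S.
have [//|notS] := in_ultra_setVsetC (u @^-1` S) U_ultra.
by have [t []] := l_cluster (~` S) S notS l_S.
Qed.

(** The limits of <v_n, w> along an ultrafilter form a bounded linear functional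
    of w; the weak cluster point is its Riesz representative. *)
Lemma bounded_weak_cluster (v_ : nat -> H) (M : R) : (forall n, `|v_ n| <= M) ->
  exists (U : set_system nat) (p : H), [/\ UltraFilter U, \oo `<=` U &
    forall w, (fun n => dot (v_ n) w : R) @ U --> (dot p w : R)].
Proof.
move=> v_bnd.
have [U [U_ultra oo_U]] := @ultraFilterLemma nat \oo _.
have dot_bnd w n : `|dot (v_ n) w : R| <= M * `|w|.
  by rewrite (le_trans (cauchy_schwarz hdot _ _)) // ler_wpM2r.
have [f f_lim] := choice (fun w => ultra_bounded_cvg U_ultra (dot_bnd w)).
have f_unique w l : (fun n => dot (v_ n) w : R) @ U --> l -> f w = l.
  by move=> h; apply: cvg_unique (f_lim w) h.
have fD x y : f (x + y) = f x + f y.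
  apply: f_unique; under eq_fun do rewrite dotDr.
  exact: cvgD (f_lim x) (f_lim y).
have fZ a x : f (a *: x) = a * f x.
  apply: f_unique; under eq_fun do rewrite dotZr.
  exact: cvgMr (f_lim x).
have f_bnd w : `|f w| <= M * `|w|.
  by apply: cvgr_to_le (cvg_norm (f_lim w)) _; exact: nearW.
have [p fp] := riesz fD fZ f_bnd.
by exists U, p; split=> // w; rewrite -fp.
Qed.

(** The functionals <u_n, _> are equi-Lipschitz. *)
Lemma closed_weak_null_directions (u_ : nat -> H) (B : R) :
  (forall n, `|u_ n| <= B) ->
  closed [set w | (fun n => dot (u_ n) w : R) @ \oo --> (0 : R)].
Proof.
move=> u_bnd w w_closure; apply/cvgr0Pnorm_le => e e0.
have B0 : 0 < B + 1 by have := u_bnd 0; have := normr_ge0 (u_ 0); lra.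
have d0 : 0 < e / 2 / (B + 1) by rewrite !divr_gt0.
have [w' [/= w'_cvg]] := w_closure _ (nbhsx_ballx w _ d0).
rewrite -ball_normE /= ltr_pdivlMr // => ww'.
have e2 : 0 < e / 2 by rewrite divr_gt0.
move/cvgr0Pnorm_le/(_ _ e2) : w'_cvg; apply: filterS => n /= un.
rewrite -(subrK w' w) dotDr (le_trans (ler_normD _ _)) //.
have := cauchy_schwarz hdot (u_ n) (w - w').
have := u_bnd n; have := normr_ge0 (w - w'); nra.
Qed.

(** Weak sequential compactness without separability. Given a weak cluster
    point p, choose n_j so that v_(n_j) - p is within 1 / (j + 1) of being
    orthogonal to v_0, ..., v_j. The directions w in which the convergence holds
    form a closed subspace W that contains every v_m. A vector orthogonal to W
    is orthogonal to each v_m, hence also to the cluster point p, so the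
    convergence is trivial in that direction. *)
Lemma bounded_weakly_converging_subsequence (v_ : nat -> H) (M : R) :
  (forall n, `|v_ n| <= M) ->
  exists (n_ : nat -> nat) (p : H),
    (forall j, (j <= n_ j)%N) /\ weakly_converges dot (v_ \o n_) p.
Proof.
move=> v_bnd.
have [U [p [U_ultra oo_U p_lim]]] := bounded_weak_cluster v_bnd.
have close j : exists n, (j <= n)%N /\
    forall m : 'I_j.+1, `|dot (v_ n - p) (v_ m) : R| <= j.+1%:R^-1.
  apply: (@filter_ex _ U); apply: filterI; first by apply: oo_U; exists j.
  apply: filter_forall => m.
  have j0 : 0 < (j.+1%:R^-1 : R) by rewrite invr_gt0.
  have /cvgrPdist_le/(_ _ j0) := p_lim (v_ m).
  by apply: filterS => n; rewrite distrC dotDl dotNl.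
have [n_ n_P] := choice close.
exists n_, p; split=> [j|]; first by have [] := n_P j.
pose u_ j := v_ (n_ j) - p.
pose W := [set w | (fun j => dot (u_ j) w : R) @ \oo --> (0 : R)].
have u_bnd j : `|u_ j| <= M + `|p| by rewrite (le_trans (ler_normB _ _)) // lerD2r.
have W_closed : closed W by exact: closed_weak_null_directions u_bnd.
have WD x y : W x -> W y -> W (x + y).
  move=> Wx Wy.
  have : (fun j => dot (u_ j) x + dot (u_ j) y : R) @ \oo --> (0 + 0 : R) by exact: cvgD.
  by rewrite addr0; under eq_fun do rewrite -dotDr.
have WZ a x : W x -> W (a *: x).
  move=> Wx.
  have : (fun j => a * dot (u_ j) x : R) @ \oo --> (a * 0 : R) by exact: cvgMr.
  by rewrite mulr0; under eq_fun do rewrite -dotZr.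
have WN x : W x -> W (- x) by rewrite -scaleN1r; exact: WZ.
have W_convex : convex_set W.
  apply/convex_setP => x y t _ Wx Wy; apply: (WD) => //; apply: WZ.
  by apply: (WD) => //; exact: WN.
have W0 : W 0 by rewrite /W /=; under eq_fun do rewrite dot0r; exact: cvg_cst.
have Wv m : W (v_ m).
  apply: (@squeeze_cvgr _ \oo _ _ (fun j => - j.+1%:R^-1) (fun j => j.+1%:R^-1)).
  - exists m => // j /= mj; rewrite -ler_norml.
    by have [_ /(_ (Ordinal (mj : (m < j.+1)%N)))] := n_P j.
  - by rewrite -oppr0; apply: cvgN; exact: cvg_harmonic.
  - exact: cvg_harmonic.
suff WT w : W w.
  move=> w; rewrite -[X in _ --> X]add0r.
  under eq_fun do rewrite -(subrK (dot p w : R) (dot _ w)).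
  apply: cvgD; last exact: cvg_cst.
  by have := WT w; rewrite /W /=; under eq_fun do rewrite dotDl dotNl.
have [Ww1 w1_min] := metric_projectionP w W_closed W_convex (ex_intro _ 0 W0).
set w1 := metric_projection W w in Ww1 w1_min.
have orth x : W x -> dot (w - w1) x = 0 :> R.
  move=> Wx; apply/eqP; rewrite eq_le; apply/andP; split.
    by have := w1_min _ (WD _ _ Ww1 Wx); rewrite addrAC subrr add0r.
  by have := w1_min _ (WD _ _ Ww1 (WN _ Wx)); rewrite addrAC subrr add0r dotNr oppr_le0.
have dotp : dot p (w - w1) = 0 :> R.
  have v0 : (fun n => dot (v_ n) (w - w1) : R) = (fun=> 0).
    by apply/funext => n; rewrite dotC orth.
  have := p_lim (w - w1); rewrite v0 => p_lim0.
  exact: cvg_unique p_lim0 (cvg_cst _).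
rewrite -(subrK w1 w); apply: (WD) => //.
rewrite /W /=; under eq_fun do rewrite /u_ dotDl dotNl dotp subr0 dotC orth //.
exact: cvg_cst.
Qed.

End Hilbert.

(** * Monotone and demicontractive operators *)

Section Operators.
Context {R : realType} {H : completeNormedModType R}.
Context {dot : {dot H for idfun}} (hdot : induces_norm dot).
Implicit Types (x y w p : H) (C : set H) (A T : H -> H).

Lemma lipschitz_norm_le (L : R) A x y :
  L.-lipschitz A -> `|A x - A y| <= L * `|x - y|.
Proof. by move=> /(_ (x, y)); apply. Qed.

(** The second form is affine in p, hence stable under convex combinations and
    weak limits. For the converse, test it at p + t (x - p) and let t tend
    to 0. *)
Lemma minty C A (L : R) p : convex_set C ->
  monotone_operator dot A -> L.-lipschitz A ->
  VI dot C A p <-> C p /\ forall x, C x -> dot (A x) (p - x) <= 0.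
Proof.
move=> /convex_setP C_convex A_mono A_lip; split=> -[Cp p_VI]; split=> // x Cx.
  by have := A_mono x p; have := p_VI x Cx; rewrite !dotE; lra.
apply: (@ge0_of_forall_small _ _ (L * `|x - p| ^+ 2)) => t /andP[t0 t1].
have t01 : 0 <= t <= 1 by rewrite ltW.
have := p_VI _ (C_convex _ _ _ t01 Cx Cp); set xt := p + t *: (x - p).
have xt_p : xt - p = t *: (x - p) by rewrite /xt addrAC subrr add0r.
rewrite -opprB xt_p dotNr dotZr oppr_le0 pmulr_rge0 // => Axt.
have := ler_dot_norm hdot (A xt - A p) (x - p).
have := lipschitz_norm_le xt p A_lip; rewrite xt_p normrZ gtr0_norm //.
have := normr_ge0 (x - p).
rewrite dotDl dotNl; nra.
Qed.

(** Exhibits Fix T as an intersection of half-spaces, one for each x; for the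
    converse take x = p. *)
Lemma demicontractive_fixP (lambda : R) T p : lambda < 1 ->
  demicontractive lambda T ->
  Fix T p <-> forall x,
    dot p (x - T x) <= dot x (x - T x) - (1 - lambda) / 2 * `|x - T x| ^+ 2.
Proof.
move=> lambda_lt1 T_demi; split=> [Tp x|].
  have := T_demi x p Tp; rewrite !(sqr_norm hdot) !dotE.
  rewrite (dotC (T x) x) (dotC p x) (dotC p (T x)); lra.
move=> /(_ p); set r := `|p - T p| ^+ 2 => r_le.
have : r <= 0 by have := sqr_ge0 `|p - T p|; rewrite -/r; nra.
rewrite exprn_even_le0 //= normr_eq0 subr_eq0 => /eqP.
by rewrite /Fix /=.
Qed.

(** By [demicontractive_fixP] and [minty] the solution set is the intersection of
    C with a family of closed half-spaces. *)
Lemma closed_convex_solution C A T (L lambda : R) :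
  closed C -> convex_set C -> monotone_operator dot A -> L.-lipschitz A ->
  lambda < 1 -> demicontractive lambda T ->
  closed (Fix T `&` VI dot C A) /\ convex_set (Fix T `&` VI dot C A).
Proof.
move=> C_closed C_convex A_mono A_lip lambda_lt1 T_demi.
pose c x := dot x (x - T x) - (1 - lambda) / 2 * `|x - T x| ^+ 2.
have -> : Fix T `&` VI dot C A =
    (\bigcap_x [set p | dot p (x - T x) <= c x]) `&`
    (C `&` \bigcap_(x in C) [set p | dot p (A x) <= dot x (A x)]).
  apply/seteqP; split=> p [].
    move=> /(demicontractive_fixP _ lambda_lt1 T_demi) Fp.
    move=> /(minty _ C_convex A_mono A_lip)[Cp p_VI]; do 2?split=> //.
    - by move=> x _; exact: Fp.
    - by move=> x Cx /=; have := p_VI x Cx; rewrite dotDr dotNr subr_le0 dotC (dotC x).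
  move=> Fp [Cp p_VI]; split.
    by apply/(demicontractive_fixP _ lambda_lt1 T_demi) => x; exact: Fp.
  apply/(minty _ C_convex A_mono A_lip); split=> // x Cx.
  by have := p_VI x Cx; rewrite /= dotDr dotNr subr_le0 dotC (dotC x).
have convexI (D E : set H) : convex_set D -> convex_set E -> convex_set (D `&` E).
  move=> /convex_setP hD /convex_setP hE; apply/convex_setP => x y t t01 [Dx Ex] [Dy Ey].
  by split; [exact: hD|exact: hE].
have convex_bigI (I : Type) (P : set I) (D : I -> set H) :
    (forall i, convex_set (D i)) -> convex_set (\bigcap_(i in P) D i).
  move=> hD; apply/convex_setP => x y t t01 Dx Dy i Pi.
  by have /convex_setP := hD i; apply; [|exact: Dx|exact: Dy].
split.
  apply: closedI; first by apply: closed_bigI => x _; exact: closed_halfspace.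
  by apply: closedI => //; apply: closed_bigI => x _; exact: closed_halfspace.
apply: (convexI); first by apply: convex_bigI => x; exact: convex_halfspace.
by apply: (convexI) => //; apply: convex_bigI => x; exact: convex_halfspace.
Qed.

(** Expand |z - p|^2: the projection inequality tested at p, together with
    <A y, y - p> >= <A p, y - p> >= 0, leaves only the error term
    gamma^2 |A y - A s|^2, which the step-size rule absorbs. *)
Lemma tseng_step C A (gamma kappa : R) (s p : H) :
  closed C -> convex_set C -> C !=set0 -> monotone_operator dot A ->
  0 < gamma -> VI dot C A p ->
  let y := metric_projection C (s - gamma *: A s) in
  let z := y - gamma *: (A y - A s) in
  gamma * `|A s - A y| <= kappa * `|s - y| ->
  `|z - p| ^+ 2 <= `|s - p| ^+ 2 - (1 - kappa ^+ 2) * `|s - y| ^+ 2.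
Proof.
move=> C_closed C_convex C_neq0 A_mono gamma0 [Cp p_VI] y z step.
have [Cy /(_ p Cp) y_min] :=
  metric_projectionP hdot (s - gamma *: A s) C_closed C_convex C_neq0.
rewrite -/y in Cy y_min.
have Ayp : 0 <= dot (A y) (y - p).
  by have := A_mono y p; have := p_VI y Cy; rewrite !dotE; lra.
have gap2 : gamma ^+ 2 * `|A y - A s| ^+ 2 <= kappa ^+ 2 * `|s - y| ^+ 2.
  have lhs_ge0 : 0 <= gamma * `|A s - A y| by rewrite mulr_ge0 // ltW.
  rewrite distrC -!exprMn ler_pXn2r // nnegrE //; exact: le_trans step.
have expand : `|z - p| ^+ 2 = `|s - p| ^+ 2 - `|s - y| ^+ 2
    + 2 * dot (s - gamma *: A s - y) (p - y) - 2 * gamma * dot (A y) (y - p)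
    + gamma ^+ 2 * `|A y - A s| ^+ 2.
  rewrite /z !(sqr_norm hdot) !dotE.
  rewrite (dotC y s) (dotC p s) (dotC p y) (dotC y (A y)) (dotC y (A s)).
  rewrite (dotC p (A y)) (dotC p (A s)) (dotC (A s) (A y)); ring.
have : 0 <= gamma * dot (A y) (y - p) by rewrite mulr_ge0 // ltW.
rewrite expand; lra.
Qed.

(** Demicontractivity says that 2 <z - T z, z - p> >= (1 - lambda) |z - T z|^2. *)
Lemma demicontractive_relaxation (lambda beta : R) T z p :
  demicontractive lambda T -> Fix T p -> 0 <= beta ->
  `|z - beta *: (z - T z) - p| ^+ 2 <=
    `|z - p| ^+ 2 - beta * (1 - lambda - beta) * `|z - T z| ^+ 2.
Proof.
move=> T_demi Tp beta0; have := T_demi z p Tp.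
have -> : T z - p = (z - p) - (z - T z) by rewrite opprB [RHS]addrC addrA subrK.
have -> : z - beta *: (z - T z) - p = (z - p) - beta *: (z - T z) by rewrite addrAC.
move: (z - T z) (z - p) => r q.
rewrite !(sqr_norm hdot) !dotE (dotC r q) => T_le.
suff : 0 <= beta * (2 * dot q r - (1 - lambda) * dot r r) by lra.
by rewrite mulr_ge0 //; lra.
Qed.

(** Since (1 - theta) v - u + theta u = (1 - theta) (v - u), taking squares gives
    an identity; the bound drops two nonnegative terms. *)
Lemma anchored_step (theta : R) (v u : H) : 0 <= theta <= 1 ->
  `|(1 - theta) *: v - u| ^+ 2 <=
    (1 - theta) * `|v - u| ^+ 2 + 2 * theta * dot u (u - (1 - theta) *: v).
Proof.
move=> /andP[theta0 theta1].
have : 0 <= theta * (1 - theta) * `|v - u| ^+ 2 + theta ^+ 2 * `|u| ^+ 2.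
  by rewrite addr_ge0 // ?mulr_ge0 ?exprn_ge0 // subr_ge0.
rewrite !(sqr_norm hdot) !dotE (dotC v u); nra.
Qed.

(** Pass to the limit in the projection inequality of v tested at y_n. *)
Lemma weak_limit_in_closed_convex C (y_ : nat -> H) (v : H) :
  closed C -> convex_set C -> (forall n, C (y_ n)) ->
  weakly_converges dot y_ v -> C v.
Proof.
move=> C_closed C_convex Cy y_v.
have C_neq0 : C !=set0 by exists (y_ 0).
have [Cq q_min] := metric_projectionP hdot v C_closed C_convex C_neq0.
set q := metric_projection C v in Cq q_min.
have : dot v (v - q) <= dot q (v - q) :> R.
  apply: cvgr_to_le (y_v (v - q)) _; apply: nearW => n.
  by have := q_min _ (Cy n); rewrite (dotC (v - q)) dotDl dotNl subr_le0.
rewrite -subr_le0 -dotNl -dotDl -(sqr_norm hdot) exprn_even_le0 //=.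
by rewrite normr_eq0 subr_eq0 => /eqP ->.
Qed.

(** The projection inequality of y_n, divided by the step size, and monotonicity
    bound <A x, y_n - x> above by a multiple of |s_n - y_n|; in the limit this is the
    Minty form of the inequality at v. *)
Lemma weak_limit_VI C A (L g : R) (s y : nat -> H) (gamma : nat -> R) (v : H) :
  closed C -> convex_set C -> C !=set0 ->
  monotone_operator dot A -> L.-lipschitz A -> 0 <= L ->
  0 < g -> (forall n, g <= gamma n) ->
  (forall n, y n = metric_projection C (s n - gamma n *: A (s n))) ->
  (fun n => s n - y n) @ \oo --> (0 : H) ->
  weakly_converges dot y v -> (exists B, forall n, `|y n| <= B) ->
  VI dot C A v.
Proof.
move=> C_closed C_convex C_neq0 A_mono A_lip L0 g0 g_le yE sy0 y_v [B y_bnd].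
have y_min n := metric_projectionP hdot (s n - gamma n *: A (s n))
  C_closed C_convex C_neq0.
have Cy n : C (y n) by rewrite yE; exact: (y_min n).1.
apply/(minty _ C_convex A_mono A_lip).
split; first exact: weak_limit_in_closed_convex C_closed C_convex Cy y_v.
move=> x Cx.
have dot_y n : dot (y n) (A x) <=
    dot x (A x) + `|s n - y n| * ((g^-1 + L) * (`|x| + B)).
  have gamma0 : 0 < gamma n by exact: lt_le_trans (g_le n).
  have := (y_min n).2 x Cx; rewrite -yE => proj.
  have ginv : gamma n * g^-1 >= 1 by rewrite ler_pdivlMr ?mul1r.
  have xy : `|x - y n| <= `|x| + B by rewrite (le_trans (ler_normB _ _)) // lerD2l.
  set n1 := `|s n - y n|; set n2 := `|x - y n| in xy *.
  have cs1 : - (n1 * n2) <= dot (s n - y n) (x - y n).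
    by rewrite lerNl -dotNl opprB (le_trans (ler_dot_norm hdot _ _)) // distrC.
  have cs2 : dot (A (s n) - A (y n)) (x - y n) <= L * (n1 * n2).
    rewrite (le_trans (ler_dot_norm hdot _ _)) // mulrA ler_wpM2r //.
    exact: lipschitz_norm_le.
  have mono : dot (A (s n)) (x - y n) - dot (A (s n) - A (y n)) (x - y n)
      <= dot (A x) (x - y n).
    by have := A_mono x (y n); rewrite !dotDl !dotNl; lra.
  have proj' : dot (s n - y n) (x - y n) <= gamma n * dot (A (s n)) (x - y n).
    by move: proj; rewrite !dotDl !dotNl dotZl; lra.
  have n1_ge0 : 0 <= n1 by exact: normr_ge0.
  have n2_ge0 : 0 <= n2 by exact: normr_ge0.
  have q_ge0 : 0 <= n1 * n2 by rewrite mulr_ge0.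
  have q_le : n1 * n2 <= n1 * (`|x| + B) by rewrite ler_wpM2l.
  have gL : 0 <= g^-1 + L by rewrite addr_ge0 // invr_ge0 ltW.
  have : - (n1 * n2) <= gamma n * (dot (A x) (x - y n) + L * (n1 * n2)).
    apply: le_trans (ler_wpM2l (ltW gamma0)
      (_ : dot (A (s n)) (x - y n) <= _)); lra.
  move=> main; have : 0 <= dot (A x) (x - y n) + n1 * n2 * (g^-1 + L).
    rewrite -(pmulr_rge0 _ gamma0).
    have := ler_wpM2l q_ge0 ginv; lra.
  have := ler_wpM2r gL q_le.
  rewrite (dotC (y n) (A x)) (dotC x (A x)) dotDr dotNr; lra.
rewrite dotDr dotNr subr_le0 (dotC _ v) (dotC _ x).
apply: (ler_cvg_to (y_v (A x))); last exact: nearW dot_y.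
rewrite -[X in _ --> X]addr0; apply: cvgD; first exact: cvg_cst.
rewrite -[X in _ --> X](mul0r ((g^-1 + L) * (`|x| + B))).
by apply: cvgMl; rewrite -(normr0 H); exact: cvg_norm.
Qed.

End Operators.

(** * Recursive inequalities *)

Section RealSequences.
Context {R : realType}.
Implicit Types (theta a d e : nat -> R).

Lemma unbounded_partial_sums theta (N : nat) (B : R) : (1 <= N)%N ->
  (forall k, (1 <= k)%N -> 0 <= theta k) ->
  (\sum_(1 <= k <oo) (theta k)%:E = +oo)%E ->
  exists n, B < \sum_(N <= k < N + n) theta k.
Proof.
move=> N1 theta0 sum_oo; apply: contrapT => /forallNP sum_le.
suff : (\sum_(1 <= k <oo) (theta k)%:E <=
    (\sum_(1 <= k < N) theta k + B)%:E)%E by rewrite sum_oo leye_eq.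
apply: lime_le; first by apply: is_cvg_nneseries => k k1 _; rewrite lee_fin theta0.
exists N => // n /= Nn.
rewrite sumEFin lee_fin (@big_cat_nat _ _ _ N) //= lerD2l.
by have /negP := sum_le (n - N)%N; rewrite -leNgt subnKC.
Qed.

(** While a > 2 eps the recursion decreases a by at least theta_k eps, which the
    divergence of the sum forbids for ever; once a <= 2 eps it stays so. *)
Lemma contraction_eventually_le theta a (eps : R) : 0 < eps ->
  (forall k, (1 <= k)%N -> 0 < theta k < 1) ->
  (\sum_(1 <= k <oo) (theta k)%:E = +oo)%E ->
  (\forall k \near \oo, a k.+1 <= (1 - theta k) * a k + theta k * eps) ->
  \forall k \near \oo, a k <= 2 * eps.
Proof.
move=> eps0 theta01 sum_oo [N0 _ step0].
pose N := N0.+1.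
have step k : (N <= k)%N -> a k.+1 <= (1 - theta k) * a k + theta k * eps.
  by move=> Nk; apply: step0; exact: leq_trans Nk.
have theta_N k : (N <= k)%N -> 0 < theta k < 1.
  by move=> Nk; apply: theta01; exact: leq_trans Nk.
have stable k j : (N <= k)%N -> a k <= 2 * eps -> a (k + j)%N <= 2 * eps.
  move=> Nk ak; elim: j => [|j IH]; first by rewrite addn0.
  have Nkj : (N <= k + j)%N by exact: leq_trans (leq_addr _ _).
  have /andP[t0 t1] := theta_N _ Nkj.
  rewrite addnS; apply: le_trans (step _ Nkj) _; nra.
suff [k Nk ak] : exists2 k, (N <= k)%N & a k <= 2 * eps.
  by exists k => // j /= kj; rewrite -(subnKC kj); exact: stable.
apply: contrapT => no_k.
have a_large k : (N <= k)%N -> 2 * eps < a k.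
  by move=> Nk; rewrite ltNge; apply/negP => ak; apply: no_k; exists k.
have decrease n : a (N + n)%N + eps * \sum_(N <= k < N + n) theta k <= a N.
  elim: n => [|n IH]; first by rewrite addn0 big_geq // mulr0 addr0.
  have Nn := leq_addr n N.
  rewrite addnS big_nat_recr //=.
  have := step _ Nn; have := a_large _ Nn; have /andP[t0 t1] := theta_N _ Nn.
  nra.
have [|n] := @unbounded_partial_sums theta N (a N / eps) isT _ sum_oo.
  by move=> k /theta01 /andP[/ltW].
rewrite ltr_pdivrMr // mulrC.
have := decrease n; have := a_large _ (leq_addr n N); lra.
Qed.

(** An index with e_k >= mu has theta_k d_k <= e_k as soon as theta_k is small,
    and an index with e_k < mu has d_k <= eps. In both cases the recursion of
    [contraction_eventually_le] holds. *)
Lemma dichotomy_cvg0 theta a d e (D : R) :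
  (forall k, (1 <= k)%N -> 0 < theta k < 1) ->
  theta @ \oo --> (0 : R) -> (\sum_(1 <= k <oo) (theta k)%:E = +oo)%E ->
  (forall k, 0 <= a k) -> (forall k, 0 <= e k) ->
  (\forall k \near \oo, d k <= D) ->
  (\forall k \near \oo, a k.+1 <= (1 - theta k) * a k + theta k * d k - e k) ->
  (forall eps, 0 < eps -> exists2 mu, 0 < mu &
     \forall k \near \oo, e k < mu -> d k <= eps) ->
  a @ \oo --> (0 : R).
Proof.
move=> theta01 theta0 sum_oo a0 e0 d_bnd step small.
apply/cvgr0Pnorm_le => eps eps0.
have eps2 : 0 < eps / 2 by rewrite divr_gt0.
suff : \forall k \near \oo, a k <= 2 * (eps / 2).
  by apply: filterS => k; rewrite ger0_norm // mulrC divfK.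
apply: (contraction_eventually_le eps2 theta01 sum_oo).
have [mu mu0 d_small] := small _ eps2.
have D0 : 0 < `|D| + 1 by have := normr_ge0 D; lra.
have theta_mu : \forall k \near \oo, theta k <= mu / (`|D| + 1).
  by apply: cvgr_le theta0 _ _; rewrite divr_gt0.
near=> k.
have k1 : (1 <= k)%N by near: k; exists 1%N.
have /andP[t0 t1] := theta01 k k1.
have stepk : a k.+1 <= (1 - theta k) * a k + theta k * d k - e k by near: k.
have dk_small : e k < mu -> d k <= eps / 2 by near: k.
have [/dk_small dk|ek] := ltP (e k) mu; first by have := e0 k; nra.
have dk : d k <= D by near: k.
have : theta k <= mu / (`|D| + 1) by near: k.
rewrite ler_pdivlMr // => tD.
have := ler_norm D; nra.
Unshelve. all: by end_near. Qed.
End RealSequences.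

Lemma convex_combination_bounded {R : realType} (theta r : nat -> R) (M : R) :
  (\forall k \near \oo, 0 <= theta k <= 1) ->
  (\forall k \near \oo, r k.+1 <= (1 - theta k) * r k + theta k * M) ->
  exists B N, forall k, (N <= k)%N -> r k <= B.
Proof.
move=> theta01 step; have [N _ NP] := filterI theta01 step.
exists (Num.max (r N) M), N => k Nk; rewrite -(subnKC Nk).
elim: (k - N)%N => [|j IH]; first by rewrite addn0 le_max lexx.
have [/andP[t0 t1] stepj] := NP _ (leq_addr j N).
rewrite addnS (le_trans stepj) //.
have : M <= Num.max (r N) M by rewrite le_max lexx orbT.
move: (Num.max _ _) IH => B rB MB; nra.
Qed.

Lemma cvg_subseq (k_ : nat -> nat) {T : topologicalType} (f : nat -> T) (l : T) :
  (forall j, (j <= k_ j)%N) -> f @ \oo --> l -> (f \o k_) @ \oo --> l.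
Proof.
move=> k_ge; apply: cvg_comp => S [N _ NS]; exists N => // j /= Nj.
by apply: NS; exact: leq_trans (k_ge j).
Qed.

(** * The steps of the algorithm *)

(** The rule gives gamma_(k+1) |A s_k - A y_k| <= phi |s_k - y_k|. The step sizes
    are nonincreasing and bounded below by min(phi / L, gamma_1) > 0, so
    gamma_k / gamma_(k+1) tends to 1 and phi can be replaced by any kappa > phi
    when gamma_(k+1) is replaced by gamma_k. *)
Lemma adaptive_stepsize {R : realType} {H : completeNormedModType R}
    (A : H -> H) (L phi : R) (gamma : nat -> R) (s y : nat -> H) :
  0 < L -> L.-lipschitz A -> 0 < phi < 1 -> 0 < gamma 1%N ->
  (forall k, (1 <= k)%N ->
     gamma k.+1 = if A (s k) - A (y k) != 0
                  then Num.min (phi * `|s k - y k| / `|A (s k) - A (y k)|)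
                               (gamma k)
                  else gamma k) ->
  exists g kappa, [/\ 0 < g, 0 < kappa < 1,
    forall k, (1 <= k)%N -> g <= gamma k &
    \forall k \near \oo, gamma k * `|A (s k) - A (y k)| <= kappa * `|s k - y k|].
Proof.
move=> L0 A_lip /andP[phi0 phi1] gamma1 gammaS.
pose g := Num.min (phi / L) (gamma 1%N).
have g0 : 0 < g by rewrite lt_min divr_gt0.
have g_le k : (1 <= k)%N -> g <= gamma k.
  elim: k => [//|[|k] IH] _; first by rewrite ge_min lexx orbT.
  rewrite gammaS //; case: ifPn => [Asy|_]; last exact: IH.
  rewrite le_min IH // andbT ge_min; apply/orP; left.
  have Asy0 : 0 < `|A (s k.+1) - A (y k.+1)| by rewrite normr_gt0.
  rewrite ler_pdivlMr // mulrAC ler_pdivrMr // -mulrA ler_wpM2l ?(ltW phi0) //.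
  by rewrite mulrC; exact: lipschitz_norm_le.
have gamma_noninc k : (1 <= k)%N -> gamma k.+1 <= gamma k.
  by move=> k1; rewrite gammaS //; case: ifP => // _; rewrite ge_min lexx orbT.
have gamma_next k : (1 <= k)%N ->
    gamma k.+1 * `|A (s k) - A (y k)| <= phi * `|s k - y k|.
  move=> k1; rewrite gammaS //; case: ifPn => [Asy|/negPn/eqP->].
    have Asy0 : 0 < `|A (s k) - A (y k)| by rewrite normr_gt0.
    by rewrite -ler_pdivlMr // ge_min lexx.
  by rewrite normr0 mulr0 mulr_ge0 // ltW.
pose kappa := (1 + phi) / 2.
exists g, kappa; split=> //; first by rewrite /kappa; lra.
have u_cvg : cvgn (fun n => gamma n.+1).
  apply: nonincreasing_is_cvgn; first by apply/nonincreasing_seqP => n; exact: gamma_noninc.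
  by exists g => _ [n _ <-]; exact: g_le.
set l := limn (fun n => gamma n.+1) in u_cvg.
have gamma_l : gamma @ \oo --> l by rewrite -cvg_shiftS.
have gammaS_l : (fun k => gamma k.+1) @ \oo --> l by rewrite cvg_shiftS.
have l0 : 0 < l.
  by apply: lt_le_trans g0 _; apply: cvgr_to_ge gammaS_l _; apply: nearW => k; exact: g_le.
have ratio : \forall k \near \oo, phi * gamma k <= kappa * gamma k.+1.
  have diff_l : (fun k => kappa * gamma k.+1 - phi * gamma k) @ \oo
      --> (kappa * l - phi * l : R).
    by apply: cvgB; exact: cvgMr.
  have diff0 : 0 < kappa * l - phi * l by rewrite /kappa; nra.
  by apply: filterS (cvgr_ge _ diff_l _ diff0) => k; rewrite subr_ge0.
near=> k.
have k1 : (1 <= k)%N by near: k; exists 1%N.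
have gk : 0 < gamma k.+1 by apply: lt_le_trans g0 (g_le _ _).
have ratiok : phi * gamma k <= kappa * gamma k.+1 by near: k.
rewrite -(ler_pM2l gk).
have := gamma_next k k1; have := lt_le_trans g0 (g_le k k1).
have := normr_ge0 (s k - y k); have := normr_ge0 (A (s k) - A (y k)).
move: `|s k - y k| `|A (s k) - A (y k)| => m n n0 m0 gk0 next.
have := ler_wpM2l (ltW gk0) next; have := ler_wpM2r m0 ratiok; lra.
Unshelve. all: by end_near. Qed.

(** Clipping the inertial parameter bounds the inertial displacement a priori,
    whatever the iterates are. *)
Lemma inertial_step_le {R : realType} {H : completeNormedModType R}
    (delta zeta : R) (x x' : H) : 0 < delta -> 0 < zeta ->
  `|(if x != x' then Num.min (zeta / `|x - x'|) delta else delta) *: (x - x')| <= zeta.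
Proof.
move=> delta0 zeta0; have [->|xx'] /= := eqVneq x x'.
  by rewrite subrr scaler0 normr0 ltW.
have n0 : 0 < `|x - x'| by rewrite normr_gt0 subr_eq0.
have min0 : 0 <= Num.min (zeta / `|x - x'|) delta.
  by rewrite le_min !ltW // divr_gt0.
by rewrite normrZ ger0_norm // -ler_pdivlMr // ge_min lexx.
Qed.

Section Steps.
Context {R : realType} {H : completeNormedModType R}.
Context {dot : {dot H for idfun}} (hdot : induces_norm dot).
Implicit Types (z p u : H) (T : H -> H).

(** Exhibits the update as a relaxation step followed by a contraction towards 0. *)
Lemma relaxed_anchored_stepE (theta eta : R) T z : theta < 1 ->
  (1 - theta - eta) *: z + eta *: T z =
  (1 - theta) *: (z - (eta / (1 - theta)) *: (z - T z)).
Proof.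
move=> theta1; have t0 : 1 - theta != 0 by rewrite subr_eq0 gt_eqF.
rewrite [RHS]scalerBr scalerA mulrC divfK // (scalerBr eta) opprB.
by rewrite (scalerBl (1 - theta)) addrAC -addrA.
Qed.

Lemma relaxed_anchored_step_norm (lambda theta eta : R) T z p :
  demicontractive lambda T -> Fix T p -> 0 <= theta < 1 ->
  0 <= eta <= (1 - lambda) * (1 - theta) ->
  `|(1 - theta - eta) *: z + eta *: T z - p| <=
    (1 - theta) * `|z - p| + theta * `|p|.
Proof.
move=> T_demi Tp /andP[theta0 theta1] /andP[eta0 eta_le].
have t0 : 0 < 1 - theta by rewrite subr_gt0.
rewrite relaxed_anchored_stepE //; set beta := eta / (1 - theta).
have beta0 : 0 <= beta by rewrite divr_ge0 // ltW.
have beta_le : beta <= 1 - lambda by rewrite ler_pdivrMr.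
set v := z - beta *: (z - T z).
have v_le : `|v - p| <= `|z - p|.
  rewrite -(@ler_pXn2r _ 2) ?nnegrE //.
  apply: le_trans (demicontractive_relaxation hdot z T_demi Tp beta0) _.
  by rewrite gerBl mulr_ge0 // mulr_ge0 // subr_ge0.
have -> : (1 - theta) *: v - p = (1 - theta) *: (v - p) - theta *: p.
  rewrite (scalerBr _ v p) -addrA (scalerBl 1 theta p) scale1r opprB.
  by rewrite addrAC subrr add0r.
rewrite (le_trans (ler_normB _ _)) // !normrZ (gtr0_norm t0).
by rewrite (ger0_norm theta0) lerD2r ler_wpM2l // ltW.
Qed.

(** With beta = eta / (1 - theta) the hypotheses give
    a <= beta <= (1 - lambda + b) / 2, so the gain beta (1 - lambda - beta) of the
    relaxation is at least a (1 - lambda - b) / 2; the factor 1 - theta costs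
    another 1 / 2. *)
Lemma relaxed_anchored_step_sqr (lambda theta eta a b : R) T z u x' :
  demicontractive lambda T -> Fix T u -> 0 <= theta <= 2^-1 ->
  0 < a -> a <= eta <= b -> b < 1 - lambda ->
  2 * b <= (1 - theta) * (1 - lambda + b) ->
  x' = (1 - theta - eta) *: z + eta *: T z ->
  `|x' - u| ^+ 2 <= (1 - theta) * `|z - u| ^+ 2 + 2 * theta * dot u (u - x')
     - a * (1 - lambda - b) / 4 * `|z - T z| ^+ 2.
Proof.
move=> T_demi Tu /andP[theta0 theta1] a0 /andP[a_eta eta_b] b_lt b_le ->.
have t0 : 0 < 1 - theta by lra.
rewrite relaxed_anchored_stepE; last by lra.
set beta := eta / (1 - theta).
have betaE : beta * (1 - theta) = eta by rewrite divfK // gt_eqF.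
have beta0 : 0 <= beta by rewrite divr_ge0 // ltW //; lra.
have a_beta : a <= beta by nra.
have beta_le : beta <= (1 - lambda + b) / 2 by rewrite ler_pdivrMr //; lra.
have theta01 : 0 <= theta <= 1 by lra.
apply: le_trans (anchored_step hdot _ _ theta01) _.
have := demicontractive_relaxation hdot z T_demi Tu beta0.
move: (dot u _) `|_ - u| => D V.
have : a * (1 - lambda - b) / 2 <= beta * (1 - lambda - beta) by nra.
have := sqr_ge0 `|z - T z|; move: (`|z - T z| ^+ 2) => r r0 coef V_le.
have := ler_wpM2r r0 coef; have := ler_wpM2l (ltW t0) V_le.
have : 0 <= a * (1 - lambda - b) * r by rewrite !mulr_ge0 // ?ltW //; lra.
nra.
Qed.

Lemma weakly_converges_perturb (v_ w_ : nat -> H) (v : H) :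
  weakly_converges dot v_ v -> (fun n => w_ n - v_ n) @ \oo --> (0 : H) ->
  weakly_converges dot w_ v.
Proof.
move=> v_v wv0 p.
have : (fun n => dot (v_ n) p + dot (w_ n - v_ n) p : R) @ \oo
    --> (dot v p + dot 0 p : R).
  by apply: cvgD; [exact: v_v|exact: cvg_dotl].
rewrite dot0l addr0.
by under eq_fun do rewrite -dotDl addrC subrK.
Qed.

Lemma cvg0_of_sqr_le (c : R) (r : nat -> H) : 0 < c ->
  (forall j, c * `|r j| ^+ 2 <= j.+1%:R^-1) -> r @ \oo --> (0 : H).
Proof.
move=> c0 r_le; apply/cvgr0Pnorm_le => eps eps0.
have ce : 0 < c * eps ^+ 2 by rewrite mulr_gt0 // exprn_gt0.
have [N _ N_small] := near_infty_natSinv_lt (PosNum ce).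
exists N => // j /N_small /= j_small.
rewrite -(@ler_pXn2r _ 2) ?nnegrE ?(ltW eps0) // -(ler_pM2l c0).
exact: le_trans (r_le j) (ltW j_small).
Qed.

End Steps.

(** * Strong convergence *)

Unset Implicit Arguments.
Set Strict Implicit.

Theorem theorem2 (R : realType) (H : completeNormedModType R)
  (dot : {dot H for idfun}) (hdot : induces_norm dot)
  (C : set H) (C_neq0 : C !=set0) (C_closed : closed C) (C_convex : convex_set C)
  (A T : H -> H)
  (L : R) (L_gt0 : 0 < L)
  (A_monotone : monotone_operator dot A) (A_lipschitz : L.-lipschitz A)
  (lambda : R) (lambda_ge0 : 0 <= lambda) (lambda_lt1 : lambda < 1)
  (T_demicontractive : demicontractive lambda T)
  (T_demiclosed : demiclosed_at_zero dot T)
  (solvable : Fix T `&` VI dot C A !=set0)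
  (theta zeta eta : nat -> R)
  (theta01 : forall k, (1 <= k)%N -> 0 < theta k < 1)
  (theta_cvg0 : theta @ \oo --> (0 : R))
  (theta_sum : (\sum_(1 <= k <oo) (theta k)%:E = +oo)%E)
  (zeta_gt0 : forall k, (1 <= k)%N -> 0 < zeta k)
  (zeta_theta : (fun k => zeta k / theta k) @ \oo --> (0 : R))
  (eta_gt0 : forall k, (1 <= k)%N -> 0 < eta k)
  (eta_ab : exists a b : R, 0 < a /\ 0 < b /\
     (forall k, (1 <= k)%N ->
       (eta k \in `]a, b[) /\
       `]a, b[%classic `<=` `]0, (1 - lambda) * (1 - theta k)[%classic))
  (delta : R) (delta_gt0 : 0 < delta)
  (phi : R) (phi01 : 0 < phi < 1)
  (x s y z : nat -> H) (delta_ gamma : nat -> R)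
  (gamma1_gt0 : 0 < gamma 1%N)
  (delta_def : forall k, (1 <= k)%N ->
     delta_ k = if x k != x k.-1
                then Num.min (zeta k / `|x k - x k.-1|) delta else delta)
  (s_def : forall k, (1 <= k)%N -> s k = x k + delta_ k *: (x k - x k.-1))
  (y_def : forall k, (1 <= k)%N ->
     y k = metric_projection C (s k - gamma k *: A (s k)))
  (z_def : forall k, (1 <= k)%N -> z k = y k - gamma k *: (A (y k) - A (s k)))
  (x_def : forall k, (1 <= k)%N ->
     x k.+1 = (1 - theta k - eta k) *: z k + eta k *: T (z k))
  (gamma_def : forall k, (1 <= k)%N ->
     gamma k.+1 = if A (s k) - A (y k) != 0
                  then Num.min (phi * `|s k - y k| / `|A (s k) - A (y k)|)
                               (gamma k)
                  else gamma k) :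
  exists u : H,
    [/\ (Fix T `&` VI dot C A) u,
        (forall p, (Fix T `&` VI dot C A) p -> `|u| <= `|p|) &
        x @ \oo --> u].
Proof.
have [Sol_closed Sol_convex] := closed_convex_solution hdot C_closed C_convex
  A_monotone A_lipschitz lambda_lt1 T_demicontractive.
set Sol := Fix T `&` VI dot C A in solvable Sol_closed Sol_convex *.
have [Sol_u u_min] := metric_projectionP hdot 0 Sol_closed Sol_convex solvable.
set u := metric_projection Sol 0 in Sol_u u_min.
(* The projection inequality of 0 onto the solution set, tested at p. *)
have u_dot p : Sol p -> 0 <= dot u (p - u).
  by move=> /u_min; rewrite sub0r dotNl oppr_le0.
exists u; split=> // [p /u_dot|].
  rewrite dotDr dotNr -(sqr_norm hdot) => up.
  have := ler_dot_norm hdot u p; have := normr_ge0 u; have := normr_ge0 p.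
  nra.
have [Tu u_VI] := Sol_u.
have [g [kappa [g0 /andP[kappa0 kappa1] g_le gap]]] :=
  adaptive_stepsize L_gt0 A_lipschitz phi01 gamma1_gt0 gamma_def.
have [a [b [a0 [b0 eta_itv]]]] := eta_ab.
have eta_a_b k : (1 <= k)%N -> a <= eta k <= b.
  by move=> k1; have [+ _] := eta_itv k k1; rewrite in_itv /= => /andP[/ltW-> /ltW].
have eta_le k : (1 <= k)%N -> 0 <= eta k <= (1 - lambda) * (1 - theta k).
  move=> k1; have [eta_k /(_ _ eta_k)] := eta_itv k k1.
  by rewrite /= in_itv /= => /andP[/ltW-> /ltW].
(* The inclusion at k = 1 already separates b from 1 - lambda, as theta_1 > 0. *)
have b_lt : b < 1 - lambda.
  have [eta_1 sub1] := eta_itv 1%N isT.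
  have := sub1 _ eta_1; rewrite /= in_itv /= => /andP[_ eta_1_lt].
  move: eta_1; rewrite in_itv /= => /andP[a_eta _].
  have /andP[t0 t1] := theta01 1%N isT.
  apply: (@le_lt_trans _ _ ((1 - lambda) * (1 - theta 1%N))); last by nra.
  rewrite leNgt; apply/negP => q_lt.
  have /sub1 : `]a, b[%classic ((1 - lambda) * (1 - theta 1%N)).
    by rewrite /= in_itv /= q_lt andbT (lt_trans a_eta).
  by rewrite /= in_itv /= ltxx andbF.
have s_near k : (1 <= k)%N -> `|s k - x k| <= zeta k.
  move=> k1; rewrite s_def // addrAC subrr add0r delta_def //.
  exact: inertial_step_le (zeta_gt0 k k1).
have one_le : \forall k \near \oo, (1 <= k)%N by exists 1%N.
have zeta_theta_le (c : R) : 0 < c -> \forall k \near \oo, zeta k <= c * theta k.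
  move=> c0; near=> k.
  have k1 : (1 <= k)%N by near: k.
  have /andP[t0 _] := theta01 k k1.
  rewrite -ler_pdivrMr //; near: k; exact: (cvgr_le _ zeta_theta _ c0).
have zeta_le_theta := zeta_theta_le _ ltr01.
have tseng : \forall k \near \oo, `|z k - u| ^+ 2 <=
    `|s k - u| ^+ 2 - (1 - kappa ^+ 2) * `|s k - y k| ^+ 2.
  near=> k; have k1 : (1 <= k)%N by near: k.
  rewrite z_def // y_def //.
  apply: (tseng_step hdot C_closed C_convex C_neq0 A_monotone _ u_VI).
    exact: lt_le_trans g0 (g_le k k1).
  by rewrite -y_def //; near: k.
have kappa2 : 0 < 1 - kappa ^+ 2 by nra.
have z_le : \forall k \near \oo, `|z k - u| <= `|x k - u| + zeta k.
  near=> k; have k1 : (1 <= k)%N by near: k.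
  have : `|z k - u| ^+ 2 <= `|s k - u| ^+ 2 - (1 - kappa ^+ 2) * `|s k - y k| ^+ 2.
    by near: k.
  have : 0 <= (1 - kappa ^+ 2) * `|s k - y k| ^+ 2 by rewrite mulr_ge0 ?sqr_ge0 // ltW.
  move=> drop le_sq; apply: (@le_trans _ _ `|s k - u|).
    by rewrite -(@ler_pXn2r _ 2) ?nnegrE //; lra.
  rewrite -(subrK (x k) (s k)) -addrA addrC (le_trans (ler_normD _ _)) //.
  by rewrite lerD2l s_near.
(* Since |z_k - u| <= |x_k - u| + zeta_k and zeta_k <= theta_k, the anchored step
   is a convex combination of |x_k - u| and |u| + 1. *)
have [B [N x_bnd]] : exists B N, forall k, (N <= k)%N -> `|x k - u| <= B.
  apply: (@convex_combination_bounded _ theta _ (`|u| + 1)).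
    near=> k; have k1 : (1 <= k)%N by near: k.
    by have /andP[/ltW-> /ltW] := theta01 k k1.
  near=> k; have k1 : (1 <= k)%N by near: k.
  have /andP[t0 t1] := theta01 k k1.
  have t01 : 0 <= theta k < 1 by rewrite ltW.
  have zk : `|z k - u| <= `|x k - u| + zeta k by near: k.
  have zt : zeta k <= 1 * theta k by near: k.
  have := relaxed_anchored_step_norm hdot (z k) T_demicontractive Tu t01 (eta_le k k1).
  rewrite -x_def //; have := zeta_gt0 k k1; nra.
have B0 : 0 <= B by apply: le_trans (x_bnd N _).
(* K is chosen so that |s_k - u|^2 <= (|x_k - u| + zeta_k)^2
   <= |x_k - u|^2 + K zeta_k once |x_k - u| <= B and zeta_k <= 1. The Tseng gain
   is halved in c1 because it is multiplied by 1 - theta_k >= 1 / 2. *)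
pose K := 2 * B + 1.
pose c1 := (1 - kappa ^+ 2) / 2; pose c2 := a * (1 - lambda - b) / 4.
have c10 : 0 < c1 by rewrite divr_gt0.
have c20 : 0 < c2 by rewrite divr_gt0 // mulr_gt0 // subr_gt0.
pose d k := K * (zeta k / theta k) + 2 * dot u (u - x k.+1).
pose e k := c1 * `|s k - y k| ^+ 2 + c2 * `|z k - T (z k)| ^+ 2.
have e1_ge0 k : 0 <= c1 * `|s k - y k| ^+ 2 by rewrite mulr_ge0 ?sqr_ge0 // ltW.
have e2_ge0 k : 0 <= c2 * `|z k - T (z k)| ^+ 2 by rewrite mulr_ge0 ?sqr_ge0 // ltW.
have theta_small (c : R) : 0 < c -> \forall k \near \oo, theta k <= c.
  by move=> c0; exact: (cvgr_le _ theta_cvg0 _ c0).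
have half0 : 0 < (2^-1 : R) by rewrite invr_gt0.
(* The threshold on theta_k below which 2 b <= (1 - theta_k) (1 - lambda + b). *)
have bl0 : 0 < (1 - lambda - b) / (1 - lambda + b) by rewrite divr_gt0 //; lra.
have descent : \forall k \near \oo, `|x k.+1 - u| ^+ 2 <=
    (1 - theta k) * `|x k - u| ^+ 2 + theta k * d k - e k.
  near=> k; have k1 : (1 <= k)%N by near: k.
  have /andP[t0 t1] := theta01 k k1.
  have t_half : theta k <= 2^-1 by near: k; exact: theta_small.
  have t_bl : theta k <= (1 - lambda - b) / (1 - lambda + b).
    by near: k; exact: theta_small.
  rewrite ler_pdivlMr in t_bl; last by lra.
  have zt : zeta k <= 1 * theta k by near: k.
  have xB : `|x k - u| <= B by apply: x_bnd; near: k; exists N.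
  have t_half0 : 0 <= theta k <= 2^-1 by rewrite ltW.
  have b_le : 2 * b <= (1 - theta k) * (1 - lambda + b) by lra.
  have step := relaxed_anchored_step_sqr hdot T_demicontractive Tu t_half0 a0
    (eta_a_b k k1) b_lt b_le (x_def k k1).
  have zk : `|z k - u| ^+ 2 <= `|s k - u| ^+ 2 - (1 - kappa ^+ 2) * `|s k - y k| ^+ 2.
    by near: k.
  have sk : `|s k - u| ^+ 2 <= `|x k - u| ^+ 2 + K * zeta k.
    have sx : `|s k - u| <= `|x k - u| + zeta k.
      rewrite -(subrK (x k) (s k)) -addrA addrC (le_trans (ler_normD _ _)) //.
      by rewrite lerD2l s_near.
    have := normr_ge0 (s k - u); have := normr_ge0 (x k - u).
    have := zeta_gt0 k k1; rewrite /K; nra.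
  have dE : theta k * d k = K * zeta k + 2 * theta k * dot u (u - x k.+1).
    rewrite /d mulrDr; congr (_ + _); last by rewrite mulrCA mulrA.
    by rewrite mulrCA (mulrC (theta k)) divfK ?gt_eqF.
  rewrite dE /e /c1 -/c2 in step *.
  have Kz : 0 <= K * zeta k by rewrite mulr_ge0 ?ltW ?zeta_gt0 // /K; lra.
  have sy0 := sqr_ge0 `|s k - y k|.
  have := mulr_ge0 (ltW kappa2) sy0.
  move: (`|z k - T (z k)| ^+ 2) (`|s k - y k| ^+ 2) (`|z k - u| ^+ 2)
    (`|s k - u| ^+ 2) (`|x k - u| ^+ 2) step zk sk {sy0}
    => r1 r2 r3 r4 r5 step zk sk r2_ge.
  have t1' : 0 <= 1 - theta k by lra.
  have := ler_wpM2l t1' zk; have := ler_wpM2l t1' sk.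
  have := mulr_ge0 (ltW t0) Kz.
  have : 0 <= (2^-1 - theta k) * ((1 - kappa ^+ 2) * r2) by rewrite mulr_ge0 // subr_ge0.
  lra.
have d_bnd : \forall k \near \oo, d k <= K + 2 * (`|u| * B).
  near=> k; have k1 : (1 <= k)%N by near: k.
  have /andP[t0 t1] := theta01 k k1.
  have zt : zeta k / theta k <= 1 by rewrite ler_pdivrMr //; near: k.
  have xB : `|x k.+1 - u| <= B by apply: x_bnd; apply: leqW; near: k; exists N.
  have := ler_dot_norm hdot u (u - x k.+1); rewrite distrC.
  have := normr_ge0 u; rewrite /d /K; nra.
suff a_cvg : (fun k => `|x k - u| ^+ 2) @ \oo --> (0 : R).
  apply/cvgrPdist_le => eps eps0.
  have eps2 : 0 < eps ^+ 2 by rewrite exprn_gt0.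
  apply: filterS (cvgr_le _ a_cvg _ eps2) => k; rewrite distrC.
  by rewrite ler_pXn2r // nnegrE // ltW.
apply: (dichotomy_cvg0 (D := K + 2 * (`|u| * B)) theta01 theta_cvg0 theta_sum
  _ _ d_bnd descent).
- by move=> k; exact: sqr_ge0.
- by move=> k; rewrite addr_ge0.
move=> eps eps0; apply: contrapT => no_mu.
(* Eventual properties that the selected indices must also satisfy, so that they
   hold along the whole subsequence. *)
pose good k := [/\ (1 <= k)%N, `|z k| <= B + 1 + `|u| &
  gamma k * `|A (s k) - A (y k)| <= kappa * `|s k - y k|].
have good_near : \forall k \near \oo, good k.
  near=> k; have k1 : (1 <= k)%N by near: k.
  split=> //; last by near: k.
  have /andP[t0 t1] := theta01 k k1.
  have zt : zeta k <= 1 * theta k by near: k.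
  have zk : `|z k - u| <= `|x k - u| + zeta k by near: k.
  have xB : `|x k - u| <= B by apply: x_bnd; near: k; exists N.
  by have := ler_normD (z k - u) u; rewrite subrK; lra.
have pick n : exists k, [/\ (n <= k)%N, good k, e k < n.+1%:R^-1 & eps < d k].
  apply: contrapT => none; apply: no_mu; exists n.+1%:R^-1; first by rewrite invr_gt0.
  near=> k.
  have nk : (n <= k)%N by near: k; exists n.
  have gk : good k by near: k.
  by move=> ek; rewrite leNgt; apply/negP => dk; apply: none; exists k.
have [m_ m_P] := choice pick.
have zm_bnd n : `|z (m_ n)| <= B + 1 + `|u| by have [_ []] := m_P n.
have [n_ [v [n_ge z_v]]] := bounded_weakly_converging_subsequence hdot zm_bnd.
pose k_ j := m_ (n_ j).
have k_ge j : (j <= k_ j)%N.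
  by apply: leq_trans (n_ge j) _; have [] := m_P (n_ j).
have k_good j : good (k_ j) by have [] := m_P (n_ j).
have k_d j : eps < d (k_ j) by have [] := m_P (n_ j).
have k_e j : e (k_ j) <= j.+1%:R^-1.
  have [_ _ /ltW e_lt _] := m_P (n_ j); apply: le_trans e_lt _.
  by rewrite lef_pV2 ?posrE // ler_nat ltnS.
have sy0 : (fun j => s (k_ j) - y (k_ j)) @ \oo --> (0 : H).
  apply: (cvg0_of_sqr_le c10) => j; apply: le_trans (k_e j).
  by rewrite /e lerDl.
have zT0 : (fun j => z (k_ j) - T (z (k_ j))) @ \oo --> (0 : H).
  apply: (cvg0_of_sqr_le c20) => j; apply: le_trans (k_e j).
  by rewrite /e lerDr.
have sy_norm0 : (fun j => `|s (k_ j) - y (k_ j)|) @ \oo --> (0 : R).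
  by rewrite -(normr0 H); exact: cvg_norm.
(* z - y = gamma (A s - A y) is controlled by the step-size rule. *)
have yz_le j : `|y (k_ j) - z (k_ j)| <= `|s (k_ j) - y (k_ j)|.
  have [k1 _ gapj] := k_good j.
  rewrite z_def // opprB addrC subrK normrZ gtr0_norm; last exact: lt_le_trans (g_le _ _).
  rewrite distrC; apply: le_trans gapj _; rewrite ler_piMl // ltW //.
have yz0 : (fun j => y (k_ j) - z (k_ j)) @ \oo --> (0 : H).
  apply/cvgr0Pnorm_le => r r0; move/cvgr0Pnorm_le/(_ _ r0) : sy0.
  by apply: filterS => j; exact: le_trans.
have y_v : weakly_converges dot (y \o k_) v.
  exact: (weakly_converges_perturb hdot z_v yz0).
have y_bnd : exists By, forall j, `|y (k_ j)| <= By.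
  have [M M_ub] := cvg_has_ub (cvgP _ sy_norm0).
  exists (B + 1 + `|u| + M) => j; rewrite -(subrK (z (k_ j)) (y (k_ j))) addrC.
  rewrite (le_trans (ler_normD _ _)) // lerD //; first by have [] := k_good j.
  by rewrite (le_trans (yz_le j)) // -[leLHS]normr_id; apply: M_ub; exists j.
have Sol_v : Sol v.
  split; first exact: T_demiclosed zT0.
  apply: (weak_limit_VI hdot C_closed C_convex C_neq0 A_monotone A_lipschitz
    (ltW L_gt0) g0 (s := s \o k_) (y := y \o k_) (gamma := gamma \o k_)) => // j /=.
    by apply: g_le; have [] := k_good j.
  by rewrite y_def //; have [] := k_good j.
have xz0 : (fun j => x (k_ j).+1 - z (k_ j)) @ \oo --> (0 : H).
  have bound0 : (fun j => theta (k_ j) * (B + 1 + `|u|) +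
      b * `|z (k_ j) - T (z (k_ j))|) @ \oo --> (0 * (B + 1 + `|u|) + b * 0 : R).
    apply: cvgD; first by apply: cvgMl; exact: (cvg_subseq k_ge theta_cvg0).
    by apply: cvgMr; rewrite -(normr0 H); exact: cvg_norm.
  apply/cvgr0Pnorm_le => r r0; rewrite mul0r mulr0 addr0 in bound0.
  apply: filterS (cvgr_le _ bound0 _ r0) => j; apply: le_trans.
  have [k1 zj _] := k_good j; have /andP[t0 t1] := theta01 _ k1.
  have /andP[eta0 _] := eta_le _ k1; have /andP[_ eta_b] := eta_a_b _ k1.
  have -> : x (k_ j).+1 - z (k_ j) =
      - (theta (k_ j) *: z (k_ j)) - eta (k_ j) *: (z (k_ j) - T (z (k_ j))).
    rewrite x_def // scalerBr !scalerBl scale1r opprB.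
    set th := theta _ *: _; set ez := eta _ *: z _; set eT := eta _ *: T _.
    rewrite addrAC (addrAC _ (- ez)) (addrAC _ (- th)) subrr add0r.
    by rewrite -addrA (addrC eT).
  rewrite (le_trans (ler_normB _ _)) // normrN !normrZ (gtr0_norm t0) (ger0_norm eta0).
  by rewrite lerD ?ler_wpM2l ?ler_wpM2r // ltW.
have x_v : weakly_converges dot (fun j => x (k_ j).+1) v.
  exact: (weakly_converges_perturb hdot z_v xz0).
have zt0 : (fun j => zeta (k_ j) / theta (k_ j)) @ \oo --> (0 : R).
  exact: (cvg_subseq k_ge zeta_theta).
have d_lim : (fun j => d (k_ j)) @ \oo --> (K * 0 + 2 * (dot u u - dot v u) : R).
  apply: cvgD; first exact: cvgMr.
  apply: cvgMr; under eq_fun do rewrite dotDr dotNr (dotC u (x _)).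
  by apply: cvgB; [exact: cvg_cst|exact: x_v].
have : eps <= K * 0 + 2 * (dot u u - dot v u).
  by apply: cvgr_to_ge d_lim _; apply: nearW => j; exact: ltW.
have := u_dot v Sol_v; rewrite dotDr dotNr (dotC u v); lra.
Unshelve. all: by end_near. Qed.
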